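(* Let $n\ge 2$. The virtual singular braid group admits the following semi-direct product decompositions: $VSG_n\cong VSPG_n\rtimes S_n$, $VSG_n\cong VST_n\rtimes S_n$, and $VSG_n\cong VSK_n\rtimes S_n$.
   Context: For $n\ge 2$, $VSG_n$ is the group with generators $\sigma_1,\dots,\sigma_{n-1},\tau_1,\dots,\tau_{n-1},v_1,\dots,v_{n-1}$ and relations (for all admissible indices): $\sigma_i\sigma_j=\sigma_j\sigma_i$, $v_iv_j=v_jv_i$, $\tau_i\tau_j=\tau_j\tau_i$, $\sigma_i\tau_j=\tau_j\sigma_i$, $\sigma_iv_j=v_j\sigma_i$, $\tau_iv_j=v_j\tau_i$ whenever $|i-j|\ge 2$; $v_i^2=1$ and $\sigma_i\tau_i=\tau_i\sigma_i$ for $1\le i\le n-1$; and for $1\le i\le n-2$: $\sigma_i\sigma_{i+1}\sigma_i=\sigma_{i+1}\sigma_i\sigma_{i+1}$, $v_iv_{i+1}v_i=v_{i+1}v_iv_{i+1}$, $\sigma_i\sigma_{i+1}\tau_i=\tau_{i+1}\sigma_i\sigma_{i+1}$, $\sigma_{i+1}\sigma_i\tau_{i+1}=\tau_i\sigma_{i+1}\sigma_i$, $v_i\sigma_{i+1}v_i=v_{i+1}\sigma_iv_{i+1}$, $v_i\tau_{i+1}v_i=v_{i+1}\tau_iv_{i+1}$. For $(\epsilon_1,\epsilon_2,\epsilon_3)\in\{(1,1,1),(1,0,1),(0,0,1)\}$, $\phi_{(\epsilon_1,\epsilon_2,\epsilon_3)}\colon VSG_n\to S_n$ is the homomorphism given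 by $\sigma_i\mapsto(i\ i+1)^{\epsilon_1}$, $\tau_i\mapsto(i\ i+1)^{\epsilon_2}$, $v_i\mapsto(i\ i+1)^{\epsilon_3}$. Set $VSPG_n=\operatorname{Ker}(\phi_{(1,1,1)})$, $VST_n=\operatorname{Ker}(\phi_{(1,0,1)})$, $VSK_n=\operatorname{Ker}(\phi_{(0,0,1)})$. The semi-direct products are those associated with a splitting of the short exact sequences $1\to\operatorname{Ker}(\phi_{(\epsilon_1,\epsilon_2,\epsilon_3)})\to VSG_n\to S_n\to1$. *)

(* Defs.v *)
From HB Require Import structures.
From mathcomp Require Import all_boot all_fingroup generic_quotient.
From mathcomp Require Import boolp zify.

Set Implicit Arguments.
Unset Strict Implicit.
Unset Printing Implicit Defensive.

Local Open Scope group_scope.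
Local Open Scope quotient_scope.

Notation "{ 'grpmorphism' G -> H }" := (UMagmaMorphism.type G H)
  (at level 0, G at level 98, H at level 99,
   format "{ 'grpmorphism'  G  ->  H }") : type_scope.

Definition group_iso (G H : groupType) : Prop :=
  exists f : {grpmorphism G -> H}, bijective f.

Section Presentation.

Variable X : choiceType.

(* (x, false) stands for x and (x, true) for its formal inverse. *)
Definition letter := (X * bool)%type.
Definition word := seq letter.

Definition gen (x : X) : letter := (x, false).
Definition inv_letter (a : letter) : letter := (a.1, ~~ a.2).
Definition inv_word (w : word) : word := rev (map inv_letter w).

Variable rel : word -> word -> Prop.

(* Since inv_letter is involutive, pres_eq_inv gives both x x^-1 = 1 and      *)
(* x^-1 x = 1.                                                                *)
Inductive pres_eq : word -> word -> Prop :=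
| pres_eq_rel u v : rel u v -> pres_eq u v
| pres_eq_inv a : pres_eq [:: a; inv_letter a] [::]
| pres_eq_refl u : pres_eq u u
| pres_eq_sym u v : pres_eq u v -> pres_eq v u
| pres_eq_trans v u w : pres_eq u v -> pres_eq v w -> pres_eq u w
| pres_eq_cat u u' v v' :
    pres_eq u u' -> pres_eq v v' -> pres_eq (u ++ v) (u' ++ v').

Definition pres_eqb (u v : word) : bool := `[< pres_eq u v >].

Fact pres_eqb_refl : reflexive pres_eqb.
Proof. by move=> u; apply/asboolP; apply: pres_eq_refl. Qed.

Fact pres_eqb_sym : symmetric pres_eqb.
Proof.
by move=> u v; apply/idP/idP => /asboolP uv; apply/asboolP; apply: pres_eq_sym.
Qed.

Fact pres_eqb_trans : transitive pres_eqb.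
Proof.
move=> v u w /asboolP uv /asboolP vw; apply/asboolP.
exact: pres_eq_trans uv vw.
Qed.

Canonical pres_equiv := EquivRel pres_eqb
  pres_eqb_refl pres_eqb_sym pres_eqb_trans.

(* The group < X | u = v whenever rel u v >. *)
Definition presented := {eq_quot pres_equiv}.

HB.instance Definition _ := Choice.on presented.

Definition pclass (w : word) : presented := \pi_presented w.

Lemma pclass_eq u v : pclass u = pclass v <-> pres_eq u v.
Proof.
split=> [/eqmodP/asboolP //|uv].
by apply/eqmodP/asboolP.
Qed.

Lemma pclassK (x : presented) : pclass (repr x) = x.
Proof. exact: reprK. Qed.

Lemma pres_eq_repr w : pres_eq (repr (pclass w)) w.
Proof. by apply/pclass_eq; rewrite pclassK. Qed.

Lemma inv_letterK : involutive inv_letter.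
Proof. by case=> x b; rewrite /inv_letter /= negbK. Qed.

Lemma inv_wordK : involutive inv_word.
Proof.
by move=> w; rewrite /inv_word map_rev revK -map_comp map_id_in // => a _;
  apply: inv_letterK.
Qed.

Lemma pres_eq_mulV w : pres_eq (w ++ inv_word w) [::].
Proof.
elim: w => [|a w IHw]; first exact: pres_eq_refl.
rewrite /inv_word /= rev_cons -cats1 -cat_cons catA -cat1s -catA.
apply: (@pres_eq_trans ([:: a] ++ [::] ++ [:: inv_letter a])).
  rewrite -!catA; apply: pres_eq_cat; first exact: pres_eq_refl.
  by rewrite catA; apply: pres_eq_cat => //; apply: pres_eq_refl.
exact: pres_eq_inv.
Qed.

Lemma pres_eq_Vmul w : pres_eq (inv_word w ++ w) [::].
Proof. by rewrite -{2}[w]inv_wordK; apply: pres_eq_mulV. Qed.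

Lemma pres_eq_invw u v : pres_eq u v -> pres_eq (inv_word u) (inv_word v).
Proof.
move=> uv; apply: (@pres_eq_trans (inv_word u ++ (v ++ inv_word v))).
  rewrite -{1}[inv_word u]cats0; apply: pres_eq_cat; first exact: pres_eq_refl.
  exact/pres_eq_sym/pres_eq_mulV.
rewrite catA -[X in pres_eq _ X]cat0s.
apply: pres_eq_cat; last exact: pres_eq_refl.
apply: pres_eq_trans (pres_eq_Vmul u).
by apply: pres_eq_cat; [apply: pres_eq_refl | apply: pres_eq_sym].
Qed.

Definition pres_mul (x y : presented) := pclass (repr x ++ repr y).
Definition pres_inv (x : presented) := pclass (inv_word (repr x)).

Lemma pclass_mul u v : pres_mul (pclass u) (pclass v) = pclass (u ++ v).
Proof. by apply/pclass_eq/pres_eq_cat; apply: pres_eq_repr. Qed.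

Lemma pclass_inv u : pres_inv (pclass u) = pclass (inv_word u).
Proof. exact/pclass_eq/pres_eq_invw/pres_eq_repr. Qed.

Fact pres_mulA : associative pres_mul.
Proof.
move=> x y z; rewrite -[x]pclassK -[y]pclassK -[z]pclassK.
by rewrite !pclass_mul catA.
Qed.

Fact pres_mul1 : left_id (pclass [::]) pres_mul.
Proof. by move=> x; rewrite -[x]pclassK pclass_mul. Qed.

Fact pres_mulr1 : right_id (pclass [::]) pres_mul.
Proof. by move=> x; rewrite -[x]pclassK pclass_mul cats0. Qed.

Fact pres_mulV : left_inverse (pclass [::]) pres_inv pres_mul.
Proof.
move=> x; rewrite -[x]pclassK pclass_inv pclass_mul; apply/pclass_eq.
exact: pres_eq_Vmul.
Qed.

Fact pres_mulrV : right_inverse (pclass [::]) pres_inv pres_mul.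
Proof.
move=> x; rewrite -[x]pclassK pclass_inv pclass_mul; apply/pclass_eq.
exact: pres_eq_mulV.
Qed.

HB.instance Definition _ := isGroup.Build presented
  pres_mulA pres_mul1 pres_mulr1 pres_mulV pres_mulrV.

Lemma pclassM u v : pclass (u ++ v) = pclass u * pclass v.
Proof. by rewrite -pclass_mul. Qed.

Lemma pclassV u : pclass (inv_word u) = (pclass u)^-1.
Proof. by rewrite -pclass_inv. Qed.

Lemma pclass_nil : pclass [::] = 1.
Proof. by []. Qed.

End Presentation.

Section Lift.

Variables (X : choiceType) (G : groupType) (f : X -> G).

Definition eval_letter (a : letter X) : G :=
  if a.2 then (f a.1)^-1 else f a.1.

Definition eval_word (w : word X) : G := \prod_(a <- w) eval_letter a.

Definition satisfies (rel : word X -> word X -> Prop) : Prop :=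
  forall u v, rel u v -> eval_word u = eval_word v.

Variable rel : word X -> word X -> Prop.

Definition pres_lift (_ : satisfies rel) (x : presented rel) : G :=
  eval_word (repr x).

Hypothesis f_rel : satisfies rel.

Lemma eval_pres_eq u v : pres_eq rel u v -> eval_word u = eval_word v.
Proof.
elim=> {u v} [u v /f_rel //|[x b]| // |u v _ -> //|v u w _ -> _ -> // |].
  rewrite /eval_word !big_cons big_nil mulg1 /eval_letter /=.
  by case: b; rewrite /= ?mulgV ?mulVg.
by move=> u u' v v' _ Eu _ Ev; rewrite /eval_word !big_cat /=; congr (_ * _).
Qed.

Lemma pres_lift_class w : pres_lift f_rel (pclass rel w) = eval_word w.
Proof. exact/eval_pres_eq/pres_eq_repr. Qed.

Lemma pres_lift_gen x : pres_lift f_rel (pclass rel [:: gen x]) = f x.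
Proof. by rewrite pres_lift_class /eval_word big_seq1. Qed.

Fact pres_lift_morphism : monoid_morphism (pres_lift f_rel).
Proof.
split; first by rewrite -pclass_nil pres_lift_class /eval_word big_nil.
move=> x y; rewrite -[x]pclassK -[y]pclassK -pclassM !pres_lift_class.
by rewrite /eval_word big_cat.
Qed.

HB.instance Definition _ :=
  isUMagmaMorphism.Build (presented rel) G (pres_lift f_rel) pres_lift_morphism.

End Lift.

Section Kernel.

Variables (G H : groupType) (f : {grpmorphism G -> H}).

Definition in_ker : {pred G} := [pred x | f x == 1].

Record gker := GKer { gker_val : G; _ : in_ker gker_val }.

HB.instance Definition _ := [isSub for gker_val].
HB.instance Definition _ := [Choice of gker by <:].

Fact in_ker_closed : group_closed in_ker.
Proof.
split=> [|x y]; rewrite !inE ?gmulf1 // => /eqP fx /eqP fy.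
by rewrite gmulfF fx fy divg1.
Qed.

HB.instance Definition _ :=
  SubChoice_isSubGroup.Build G in_ker gker in_ker_closed.

End Kernel.

(* Group morphisms from H to Aut K, with Aut K composed as functions; each    *)
(* map is invertible by the first two axioms.                                 *)
Record aut_action (H K : groupType) := AutAction {
  aact :> H -> K -> K;
  aact_one : forall k, aact 1 k = k;
  aact_comp : forall g h k, aact (g * h) k = aact g (aact h k);
  aact_mul : forall h k l, aact h (k * l) = aact h k * aact h l
}.

(* The action is a parameter of the type, so that the semidirect product law  *)
(* does not compete with the direct product law of K * H.                     *)
Definition sdprod_type (K H : groupType) (a : aut_action H K) := (K * H)%type.

HB.instance Definition _ (K H : groupType) (a : aut_action H K) :=
  Choice.copy (sdprod_type a) (K * H)%type.

Section SemidirectProduct.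

Variables (K H : groupType) (a : aut_action H K).

Local Notation sdprod_type := (sdprod_type a).

Definition sdprod_mul (x y : sdprod_type) : sdprod_type :=
  (x.1 * a x.2 y.1, x.2 * y.2).
Definition sdprod_one : sdprod_type := (1, 1).
Definition sdprod_inv (x : sdprod_type) : sdprod_type :=
  (a x.2^-1 x.1^-1, x.2^-1).

Lemma aact1 h : a h 1 = 1.
Proof. by apply: (@mulgI _ (a h 1)); rewrite -aact_mul !mulg1. Qed.

Fact sdprod_mulA : associative sdprod_mul.
Proof. by move=> x y z; rewrite /sdprod_mul /= aact_mul aact_comp !mulgA. Qed.

Fact sdprod_mul1 : left_id sdprod_one sdprod_mul.
Proof. by case=> k h; rewrite /sdprod_mul /= aact_one !mul1g. Qed.

Fact sdprod_mulr1 : right_id sdprod_one sdprod_mul.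
Proof. by case=> k h; rewrite /sdprod_mul /= aact1 !mulg1. Qed.

Fact sdprod_mulV : left_inverse sdprod_one sdprod_inv sdprod_mul.
Proof.
by case=> k h; rewrite /sdprod_mul /= -aact_mul !mulVg aact1.
Qed.

Fact sdprod_mulrV : right_inverse sdprod_one sdprod_inv sdprod_mul.
Proof.
by case=> k h; rewrite /sdprod_mul /= -aact_comp !mulgV aact_one mulgV.
Qed.

HB.instance Definition _ := isGroup.Build sdprod_type
  sdprod_mulA sdprod_mul1 sdprod_mulr1 sdprod_mulV sdprod_mulrV.

Lemma sdprodE (k l : K) (g h : H) :
  ((k, g) : sdprod_type) * (l, h) = (k * a g l, g * h) :> sdprod_type.
Proof. by []. Qed.

End SemidirectProduct.

Definition semidirect (K H : groupType) (a : aut_action H K) : groupType :=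
  sdprod_type a.

Arguments semidirect : clear implicits.

Section ConjugationAction.

Variables (G H : groupType) (f : {grpmorphism G -> H}).
Variable s : {grpmorphism H -> G}.

(* The left action h . k = s(h) k s(h)^-1; MathComp's k ^ x is x^-1 k x.      *)
Fact conj_in_ker (h : H) (k : gker f) : in_ker f (s h * val k * (s h)^-1).
Proof.
case: k => k /= /eqP fk; apply/eqP.
by rewrite !gmulfM gmulfV fk mulg1 mulgV.
Qed.

Definition conj_ker (h : H) (k : gker f) : gker f := GKer (conj_in_ker h k).

Fact conj_ker_one k : conj_ker 1 k = k.
Proof. by apply/val_inj; rewrite /= gmulf1 mul1g invg1 mulg1. Qed.

Fact conj_ker_comp g h k : conj_ker (g * h) k = conj_ker g (conj_ker h k).
Proof. by apply/val_inj; rewrite /= gmulfM invgM !mulgA. Qed.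

Fact conj_ker_mul h k l : conj_ker h (k * l) = conj_ker h k * conj_ker h l.
Proof. by apply/val_inj; rewrite /= !mulgA mulgVK. Qed.

Definition conj_action : aut_action H (gker f) :=
  AutAction conj_ker_one conj_ker_comp conj_ker_mul.

End ConjugationAction.

(* Indices are shifted by one: strands are numbered by 'I_n and the i-th      *)
(* generator of each kind, for i : 'I_n.-1, involves strands i and i + 1.     *)
Inductive vsg_gen (n : nat) :=
| GSigma of 'I_n.-1
| GTau of 'I_n.-1
| GV of 'I_n.-1.

Section VsgGenChoice.

Variable n : nat.

Definition vsg_gen_code (x : vsg_gen n) : 'I_n.-1 + ('I_n.-1 + 'I_n.-1) :=
  match x with
  | GSigma i => inl i | GTau i => inr (inl i) | GV i => inr (inr i)
  end.

Definition vsg_gen_decode (x : 'I_n.-1 + ('I_n.-1 + 'I_n.-1)) : vsg_gen n :=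
  match x with
  | inl i => GSigma i | inr (inl i) => GTau i | inr (inr i) => GV i
  end.

Fact vsg_gen_codeK : cancel vsg_gen_code vsg_gen_decode.
Proof. by case. Qed.

HB.instance Definition _ := Equality.copy (vsg_gen n) (can_type vsg_gen_codeK).
HB.instance Definition _ := Choice.copy (vsg_gen n) (can_type vsg_gen_codeK).

End VsgGenChoice.

Section VSG.

Variable n : nat.

Local Notation s i := (gen (GSigma i)).
Local Notation t i := (gen (GTau i)).
Local Notation v i := (gen (GV i)).

(* |i - j| >= 2 *)
Definition far (i j : 'I_n.-1) : bool := (i.+2 <= j) || (j.+2 <= i).

Inductive vsg_rel : word (vsg_gen n) -> word (vsg_gen n) -> Prop :=
| vsg_far_ss i j : far i j -> vsg_rel [:: s i; s j] [:: s j; s i]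
| vsg_far_vv i j : far i j -> vsg_rel [:: v i; v j] [:: v j; v i]
| vsg_far_tt i j : far i j -> vsg_rel [:: t i; t j] [:: t j; t i]
| vsg_far_st i j : far i j -> vsg_rel [:: s i; t j] [:: t j; s i]
| vsg_far_sv i j : far i j -> vsg_rel [:: s i; v j] [:: v j; s i]
| vsg_far_tv i j : far i j -> vsg_rel [:: t i; v j] [:: v j; t i]
| vsg_vv i : vsg_rel [:: v i; v i] [::]
| vsg_st i : vsg_rel [:: s i; t i] [:: t i; s i]
| vsg_sss (i j : 'I_n.-1) : j = i.+1 :> nat ->
    vsg_rel [:: s i; s j; s i] [:: s j; s i; s j]
| vsg_vvv (i j : 'I_n.-1) : j = i.+1 :> nat ->
    vsg_rel [:: v i; v j; v i] [:: v j; v i; v j]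
| vsg_sst (i j : 'I_n.-1) : j = i.+1 :> nat ->
    vsg_rel [:: s i; s j; t i] [:: t j; s i; s j]
| vsg_sst' (i j : 'I_n.-1) : j = i.+1 :> nat ->
    vsg_rel [:: s j; s i; t j] [:: t i; s j; s i]
| vsg_vsv (i j : 'I_n.-1) : j = i.+1 :> nat ->
    vsg_rel [:: v i; s j; v i] [:: v j; s i; v j]
| vsg_vtv (i j : 'I_n.-1) : j = i.+1 :> nat ->
    vsg_rel [:: v i; t j; v i] [:: v j; t i; v j].

Definition VSG : groupType := presented vsg_rel.

Definition sigma (i : 'I_n.-1) : VSG := pclass vsg_rel [:: s i].
Definition tau (i : 'I_n.-1) : VSG := pclass vsg_rel [:: t i].
Definition vgen (i : 'I_n.-1) : VSG := pclass vsg_rel [:: v i].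

Fact ltn_strand (i : 'I_n.-1) : i < n.
Proof. exact: leq_trans (ltn_ord i) (leq_pred n). Qed.

Fact ltn_strandS (i : 'I_n.-1) : i.+1 < n.
Proof. by have := ltn_ord i; case: n i => [[]|m i]. Qed.

(* MathComp composes permutations from left to right; a map sending the       *)
(* generators to powers of transpositions satisfies the relations for either  *)
(* convention, with the same kernel.                                          *)
Definition adj_tperm (i : 'I_n.-1) : 'S_n :=
  tperm (Ordinal (ltn_strand i)) (Ordinal (ltn_strandS i)).

Lemma adj_tperm2 i : adj_tperm i * adj_tperm i = 1.
Proof. exact: tperm2. Qed.

Lemma adj_tperm_far i j : far i j ->
  adj_tperm i * adj_tperm j = adj_tperm j * adj_tperm i.
Proof.
move=> Fij; apply/commgP/conjg_fixP; rewrite tpermJ /adj_tperm.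
by rewrite !tpermD // -val_eqE /=; move: Fij; rewrite /far; lia.
Qed.

Lemma adj_tperm_braid (i j : 'I_n.-1) : j = i.+1 :> nat ->
  adj_tperm i * adj_tperm j * adj_tperm i =
  adj_tperm j * adj_tperm i * adj_tperm j.
Proof.
move=> Eij; have ij : Ordinal (ltn_strandS i) = Ordinal (ltn_strand j).
  exact/val_inj.
rewrite /adj_tperm ij; set x := Ordinal (ltn_strand i).
set y := Ordinal (ltn_strand j); set z := Ordinal (ltn_strandS j).
have xy : x != y by rewrite -val_eqE /= Eij ltn_eqF.
have yz : y != z by rewrite -val_eqE /= ltn_eqF.
have xz : x != z by rewrite -val_eqE /= Eij ltn_eqF // ltnW.
have -> : tperm x y * tperm y z * tperm x y = tperm y z ^ tperm x y.
  by rewrite conjgE tpermV mulgA.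
have -> : tperm y z * tperm x y * tperm y z = tperm x y ^ tperm y z.
  by rewrite conjgE tpermV mulgA.
rewrite !tpermJ tpermR tpermL [tperm x y z]tpermD ?[tperm y z x]tpermD //.
all: by rewrite eq_sym.
Qed.

Definition admissible (e1 e2 e3 : nat) : bool :=
  (e1, e2, e3) \in [:: (1, 1, 1); (1, 0, 1); (0, 0, 1)]%N.

Definition phi_gen (e1 e2 e3 : nat) (x : vsg_gen n) : 'S_n :=
  match x with
  | GSigma i => adj_tperm i ^+ e1
  | GTau i => adj_tperm i ^+ e2
  | GV i => adj_tperm i ^+ e3
  end.

Fact phi_gen_satisfies e1 e2 e3 :
  admissible e1 e2 e3 -> satisfies (phi_gen e1 e2 e3) vsg_rel.
Proof.
rewrite /admissible !inE => he u w.
case=> [i j H|i j H|i j H|i j H|i j H|i j H|i|i|i j H|i j H|i j H|i j H|i j H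
       |i j H]; rewrite /eval_word !big_cons !big_nil /eval_letter /= ?mulg1;
  try by apply: commuteX2; apply: adj_tperm_far.
- by case/or3P: he => /eqP [_ _ ->]; apply: adj_tperm2.
- exact/commuteX2.
all: have B := adj_tperm_braid H; rewrite -!mulgA in B.
all: case/or3P: he => /eqP [E1 E2 E3]; rewrite ?E1 ?E2 ?E3.
all: by rewrite ?expg1 ?expg0 ?mul1g ?mulg1 // ?adj_tperm2.
Qed.

Definition phi (e1 e2 e3 : nat) (he : admissible e1 e2 e3) :
  {grpmorphism VSG -> 'S_n} := pres_lift (phi_gen_satisfies he).

Lemma phi_sigma e1 e2 e3 (he : admissible e1 e2 e3) i :
  phi he (sigma i) = adj_tperm i ^+ e1.
Proof. exact: pres_lift_gen. Qed.

Lemma phi_tau e1 e2 e3 (he : admissible e1 e2 e3) i :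
  phi he (tau i) = adj_tperm i ^+ e2.
Proof. exact: pres_lift_gen. Qed.

Lemma phi_vgen e1 e2 e3 (he : admissible e1 e2 e3) i :
  phi he (vgen i) = adj_tperm i ^+ e3.
Proof. exact: pres_lift_gen. Qed.

End VSG.

Arguments phi n {e1 e2 e3} he.

Definition phi111 n := phi n (isT : admissible 1 1 1).
Definition phi101 n := phi n (isT : admissible 1 0 1).
Definition phi001 n := phi n (isT : admissible 0 0 1).

Definition VSPG n : groupType := gker (phi111 n).
Definition VST n : groupType := gker (phi101 n).
Definition VSK n : groupType := gker (phi001 n).

(* Main.v *)
(* An extension G -> H with a section s is the semidirect product of its      *)
(* kernel by H, through g |-> (g s(f g)^-1, f g). The section exists because  *)
(* S_n has the Coxeter presentation, whose relations the v_i satisfy: every   *)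
(* element of the subgroup generated by v_0, ..., v_m is y v_m ... v_k with   *)
(* y in the subgroup generated by v_0, ..., v_(m-1), and its permutation      *)
(* sends m + 1 to k. If this permutation is trivial, then k = m + 1 and       *)
(* induction on m applies, so the subgroup generated by the v_i maps          *)
(* bijectively onto S_n.                                                      *)
Require Import Defs.
From HB Require Import structures.
From mathcomp Require Import all_boot all_fingroup.
From mathcomp Require Import boolp zify.

Set Implicit Arguments.
Unset Strict Implicit.
Unset Printing Implicit Defensive.

Local Open Scope group_scope.

(** All three homomorphisms send [vgen i] to the adjacent transposition, so a single section
    argument serves every kernel. Surjectivity of the subgroup generated by the v_i onto S_n is
    [vgenerated_surj]. Injectivity is [vgenerated_inj1], which rests on the normal form
    [vgenerated_coset]. Inverting this bijection gives [coxeter_section], and [split_semidirect]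
    turns the section into a decomposition. *)

Lemma split_semidirect (G H : groupType) (f : {grpmorphism G -> H})
    (s : {grpmorphism H -> G}) :
  cancel s f -> group_iso G (semidirect (gker f) H (conj_action f s)).
Proof.
move=> sK.
have kerP (g : G) : in_ker f (g * (s (f g))^-1).
  by apply/eqP; rewrite gmulfM gmulfV sK mulgV.
pose F (g : G) : semidirect (gker f) H (conj_action f s) :=
  (GKer (kerP g), f g).
have F_morph : monoid_morphism F.
  split=> [|x y].
    congr (_, _); last exact: gmulf1.
    by apply/val_inj; rewrite /= !gmulf1 mul1g invg1.
  rewrite Defs.sdprodE; congr (_, _); last exact: gmulfM.
  by apply/val_inj; rewrite /= !gmulfM invgM !mulgA mulgVK.
pose Fm : {grpmorphism G -> semidirect (gker f) H (conj_action f s)} :=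
  HB.pack F (isUMagmaMorphism.Build _ _ F F_morph).
exists Fm, (fun x : semidirect (gker f) H (conj_action f s) => val x.1 * s x.2).
  by move=> g; rewrite /= mulgVK.
case=> k h; have /eqP fk : f (val k) == 1 := valP k.
have Efg : f (val k * s h) = h by rewrite gmulfM fk sK mul1g.
congr (_, _) => //; apply/val_inj; rewrite /= Efg.
exact: mulgK.
Qed.

Section Coxeter.

Variables (N : nat) (G : groupType) (v : nat -> G).

Hypothesis v_sq : forall i, i < N -> v i * v i = 1.
Hypothesis v_far : forall i j, i.+1 < j -> j < N -> commute (v i) (v j).
Hypothesis v_braid :
  forall i, i.+1 < N -> v i * v i.+1 * v i = v i.+1 * v i * v i.+1.

(** Inverses need no constructor: the v_i with i < N are involutions, so for m <= N this is already
    a subgroup. *)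
Inductive vgenerated (m : nat) : G -> Prop :=
| vgenerated1 : vgenerated m 1
| vgeneratedMv x i : i < m -> vgenerated m x -> vgenerated m (x * v i).

Lemma vgeneratedM m x y :
  vgenerated m x -> vgenerated m y -> vgenerated m (x * y).
Proof.
move=> Hx; elim=> [|z i im Hz IH]; first by rewrite mulg1.
by rewrite mulgA; apply: vgeneratedMv.
Qed.

Lemma vgenerated_v m i : i < m -> vgenerated m (v i).
Proof. by rewrite -[v i]mul1g => im; apply: vgeneratedMv (vgenerated1 m). Qed.

Lemma vgeneratedV m x : m <= N -> vgenerated m x -> vgenerated m x^-1.
Proof.
move=> mN; elim=> [|z i im Hz IH]; first by rewrite invg1; apply: vgenerated1.
rewrite invgM; apply: vgeneratedM => //.
rewrite (mulg1_eq (v_sq _)) ?(leq_trans im) //; exact: vgenerated_v.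
Qed.

(* v_(k+d-1) ... v_(k+1) v_k *)
Fixpoint vdesc (k d : nat) : G :=
  if d is d'.+1 then v (k + d') * vdesc k d' else 1.

Lemma vdesc_cat k a b : vdesc k (a + b) = vdesc (k + a) b * vdesc k a.
Proof.
elim: b => [|b IHb]; first by rewrite addn0 mul1g.
by rewrite addnS /= IHb addnA mulgA.
Qed.

Lemma vdesc_commute k d x :
  (forall i, k <= i < k + d -> commute x (v i)) -> commute x (vdesc k d).
Proof.
elim: d => [|d IHd] H /=; first exact: commute1.
apply: commuteM; first by apply: H; lia.
by apply: IHd => i Hi; apply: H; lia.
Qed.

(** Right multiplication by a generator permutes the cosets represented by the words v_m ... v_k;
    the cases compare its index i with k. *)
Lemma vgenerated_coset m x : m < N -> vgenerated m.+1 x ->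
  exists y k, [/\ vgenerated m y, k <= m.+1 & x = y * vdesc k (m.+1 - k)].
Proof.
move=> mN; elim=> {x} [|x i im _ [y [k [Hy km ->]]]].
  exists 1, m.+1; split=> //; first exact: vgenerated1.
  by rewrite subnn mulg1.
(* The new letter prolongs the descending word. *)
have [Eik|] := eqVneq k i.+1.
  exists y, i; split=> //; first lia.
  have -> : m.+1 - i = (1 + (m.+1 - k))%N by lia.
  by rewrite vdesc_cat /= addn0 mulg1 Eik addn1 mulgA.
(* The new letter cancels the last letter of the word. *)
have [Eik _|] := eqVneq k i.
  exists y, k.+1; split=> //; first lia.
  have -> : m.+1 - k = (1 + (m.+1 - k.+1))%N by lia.
  rewrite vdesc_cat /= addn0 mulg1 Eik addn1 -!mulgA v_sq ?mulg1 //.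
  lia.
move=> nik nik1; have [ik|ki] := ltnP i k.
  (* Here i + 2 <= k, so v_i commutes with the whole word and joins y. *)
  exists (y * v i), k; split=> //; first by apply: vgeneratedMv => //; lia.
  rewrite -!mulgA; congr (_ * _).
  by apply/esym/vdesc_commute => j Hj; apply: v_far; lia.
case: i im ki nik nik1 => [|i] im ki nik nik1; first lia.
(* The new letter is now v_(i+1), with k <= i. It moves left to the factor v_(i+1) v_i of the word,
   where the braid relation gives v_(i+1) v_i v_(i+1) = v_i v_(i+1) v_i; the leading v_i then
   commutes past v_m ... v_(i+2) into y. *)
exists (y * v i), k; split=> //; first by apply: vgeneratedMv => //; lia.
have -> : m.+1 - k = (((i - k) + 2) + (m - i.+1))%N by lia.
rewrite !vdesc_cat /=.
have -> : (k + (i - k + 2) = i.+2)%N by lia.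
have -> : (k + (i - k) + 1 = i.+1)%N by lia.
have -> : (k + (i - k) + 0 = i)%N by lia.
rewrite mulg1 -!mulgA; congr (_ * _).
have C1 : commute (v i.+1) (vdesc k (i - k)).
  by apply: vdesc_commute => j Hj; apply/commute_sym/v_far; lia.
have C2 : commute (v i) (vdesc i.+2 (m - i.+1)).
  by apply: vdesc_commute => j Hj; apply: v_far; lia.
rewrite [v i * (vdesc i.+2 _ * _)]mulgA C2 -!mulgA; congr (_ * _).
rewrite -[vdesc k _ * _]C1 !mulgA; congr (_ * _).
by rewrite -v_braid //; lia.
Qed.

Variable h : {grpmorphism G -> 'S_N.+1}.

Hypothesis h_v : forall i, i < N -> h (v i) = tperm (inord i) (inord i.+1).

Lemma vgenerated_fix m j x : m < j <= N -> vgenerated m x ->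
  h x (inord j) = inord j.
Proof.
move=> mj; elim=> [|y i im _ IH]; first by rewrite gmulf1 perm1.
rewrite gmulfM permM IH h_v; last lia.
by rewrite tpermD // -val_eqE /= !inordK; lia.
Qed.

Lemma vdesc_last k d : k + d <= N -> h (vdesc k d) (inord (k + d)) = inord k.
Proof.
elim: d => [|d IHd] kd /=; first by rewrite gmulf1 perm1 addn0.
rewrite gmulfM permM h_v; last lia.
by rewrite addnS tpermR IHd //; lia.
Qed.

Lemma vgenerated_inj1 m x : m <= N -> vgenerated m x -> h x = 1 -> x = 1.
Proof.
elim: m x => [|m IHm] x mN Hx hx; first by case: Hx => // y i; lia.
have [y [k [Hy km Ex]]] := vgenerated_coset mN Hx.
have Ek : k = m.+1.
  (* Permutations compose from left to right: y acts first and fixes m + 1, then the descending word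
     carries m + 1 down to k. *)
  have : h x (inord m.+1) = inord k.
    rewrite Ex gmulfM permM (vgenerated_fix (m := m)) //; last lia.
    by rewrite -{2}(subnKC km) vdesc_last //; lia.
  rewrite hx perm1 => /(congr1 val); rewrite /= !inordK; lia.
move: Ex; rewrite Ek subnn mulg1 => Exy.
by apply: IHm hx => //; [lia | rewrite Exy].
Qed.

Lemma vgenerated_tperm i j : i < j <= N ->
  exists2 x, vgenerated N x & h x = tperm (inord i) (inord j).
Proof.
elim: j => [|j IHj] ij; first lia.
have [<-|nij] := eqVneq i j.
  by exists (v i); [apply: vgenerated_v; lia | rewrite h_v //; lia].
have [|x Hx hx] := IHj; first lia.
have Hv : vgenerated N (v j) by apply: vgenerated_v; lia.
(* The transposition (i j+1) is the conjugate of (i j) by (j j+1). *)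
exists (v j * x * v j); first by apply: vgeneratedM => //; apply: vgeneratedM.
have -> : tperm (inord i) (inord j.+1) =
    h x ^ tperm (inord j) (inord j.+1) :> 'S_N.+1.
  by rewrite hx tpermJ tpermL tpermD // -val_eqE /= !inordK; lia.
by rewrite conjgE tpermV !gmulfM h_v ?mulgA //; lia.
Qed.

Lemma vgenerated_surj (p : 'S_N.+1) : exists2 x, vgenerated N x & h x = p.
Proof.
have [ts -> dts] := prod_tpermP p; elim: ts dts => [_|[a b] ts IH] /=.
  by rewrite big_nil; exists 1; [apply: vgenerated1 | apply: gmulf1].
case/andP; rewrite /dpair /= => ab /IH [y Hy hy].
rewrite big_cons -hy /=.
wlog lab : a b ab / a < b => [W|].
  case: (ltngtP a b) => [|lba|/val_inj eab]; first exact: W.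
    by rewrite tpermC; apply: W => //; rewrite eq_sym.
  by rewrite eab eqxx in ab.
have [|x Hx hx] := @vgenerated_tperm a b; first by have := ltn_ord b; lia.
exists (x * y); first exact: vgeneratedM.
by rewrite gmulfM hx !inord_val.
Qed.

Lemma coxeter_section :
  exists s : {grpmorphism 'S_N.+1 -> G}, cancel s h.
Proof.
have ex p : exists x, vgenerated N x /\ h x = p.
  by have [x Hx hx] := vgenerated_surj p; exists x.
pose s p := sval (cid (ex p)).
have sP p : vgenerated N (s p) /\ h (s p) = p := svalP (cid (ex p)).
(* Injectivity makes the chosen lift the only one in the subgroup, which forces the choice to be
   multiplicative. *)
have s_uniq x p : vgenerated N x -> h x = p -> s p = x.
  move=> Hx hx; have [Hs hs] := sP p.
  apply/divg1_eq/(vgenerated_inj1 (leqnn N)).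
    by apply: vgeneratedM => //; apply: vgeneratedV.
  by rewrite gmulfF hs hx mulgV.
have s_morph : monoid_morphism s.
  split=> [|p q]; first by apply: s_uniq; [apply: vgenerated1 | apply: gmulf1].
  have [[Hp hp] [Hq hq]] := (sP p, sP q).
  by apply: s_uniq; [apply: vgeneratedM | rewrite gmulfM hp hq].
pose S : {grpmorphism 'S_N.+1 -> G} :=
  HB.pack s (isUMagmaMorphism.Build _ _ s s_morph).
by exists S => p; have [] := sP p.
Qed.

End Coxeter.

Lemma vsg_section n (h : {grpmorphism VSG n -> 'S_n}) : 1 < n ->
  (forall i, h (vgen i) = adj_tperm i) ->
  exists s : {grpmorphism 'S_n -> VSG n}, cancel s h.
Proof.
case: n h => [|[|n]] // h _ h_v.
have rel_eq u w : vsg_rel u w -> pclass (@vsg_rel n.+2) u = pclass _ w.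
  by move=> uw; apply/pclass_eq/pres_eq_rel.
(* [inord] extends the generators to all natural indices; only indices up to n are used, where it is
   faithful. *)
apply: (@coxeter_section n.+1 (VSG n.+2)
  (fun i => @vgen n.+2 (@inord n i)) _ _ _ h).
- by move=> i _; rewrite /vgen -pclassM; apply/rel_eq/vsg_vv.
- move=> i j ij jn; rewrite /commute /vgen -!pclassM; apply/rel_eq/vsg_far_vv.
  by rewrite /far !inordK; lia.
- move=> i i1n; pose w (j : nat) := [:: gen (@GV n.+2 (@inord n j))].
  have : vsg_rel (w i ++ w i.+1 ++ w i) (w i.+1 ++ w i ++ w i.+1).
    by apply: vsg_vvv; rewrite !inordK; lia.
  by move/rel_eq; rewrite !pclassM !mulgA.
- move=> i iN; rewrite h_v /adj_tperm.
  by congr tperm; apply/val_inj; rewrite /= !inordK; lia.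
Qed.

Theorem proposition21 (n : nat) (hn : 2 <= n) :
  [/\ exists s : {grpmorphism 'S_n -> VSG n},
        cancel s (phi111 n) /\
        group_iso (VSG n) (semidirect (VSPG n) 'S_n (conj_action (phi111 n) s)),
      exists s : {grpmorphism 'S_n -> VSG n},
        cancel s (phi101 n) /\
        group_iso (VSG n) (semidirect (VST n) 'S_n (conj_action (phi101 n) s))
    & exists s : {grpmorphism 'S_n -> VSG n},
        cancel s (phi001 n) /\
        group_iso (VSG n) (semidirect (VSK n) 'S_n (conj_action (phi001 n) s))].
Proof.
have splits (h : {grpmorphism VSG n -> 'S_n}) :
    (forall i, h (vgen i) = adj_tperm i) ->
    exists s : {grpmorphism 'S_n -> VSG n}, cancel s h /\
      group_iso (VSG n) (semidirect (gker h) 'S_n (conj_action h s)).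
  case/(vsg_section hn) => s sK; exists s; split=> //.
  exact: split_semidirect.
(* The third exponent is 1 in each case, and the power [^+ 1] reduces to the transposition
   itself. *)
by split; apply: splits => i; apply: phi_vgen.
Qed.
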